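(* For any convex function $L:\mathbb{R}^n\to\mathbb{R}$, there exists a Borel measurable map $y:\mathbb{R}^n\to\mathbb{R}^n$ such that $y(x)\in\partial L(x)$ for every $x\in\mathbb{R}^n$.
   Context: For a convex function $L:\mathbb{R}^n\to\mathbb{R}$ and $x\in\mathbb{R}^n$, the subdifferential of $L$ at $x$ is $$\partial L(x)=\{y\in\mathbb{R}^n: L(z)\ge L(x)+\langle y,z-x\rangle \text{ for all } z\in\mathbb{R}^n\}.$$ *)

(* Defs.v *)
From mathcomp Require Import all_boot all_order all_algebra.
From mathcomp Require Import all_classical all_reals all_analysis.

Set Implicit Arguments.
Unset Strict Implicit.
Unset Printing Implicit Defensive.

Import Order.TTheory GRing.Theory Num.Theory.
Import numFieldNormedType.Exports.

Local Open Scope classical_set_scope.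
Local Open Scope ring_scope.

Definition dotprod (R : realType) (n : nat) (u v : 'rV[R]_n) : R :=
  \sum_(i < n) u ord0 i * v ord0 i.

Definition subdifferential (R : realType) (n : nat) (L : 'rV[R]_n -> R)
    (x : 'rV[R]_n) : set 'rV[R]_n :=
  [set y | forall z, L x + dotprod y (z - x) <= L z].

(* The library's topology on 'rV[R]_n is entrywise convergence, i.e. the
   Euclidean one, so this is the Borel sigma-algebra of R^n. *)
Definition borel_rV (R : realType) (n : nat) :=
  g_sigma_algebraType (@open 'rV[R]_n).

Definition borel_measurable (R : realType) (m n : nat)
    (f : 'rV[R]_m -> 'rV[R]_n) : Prop :=
  @measurable_fun _ _ (borel_rV R m) (borel_rV R n) setT f.

(* Main.v *)
(* Let f(v) = L(x + v) and let p_0 be its directional derivative at 0, which is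
   sublinear and satisfies p_0(v) <= L(x + v) - L(x). Replacing a sublinear p
   by its directional derivative at a yields a sublinear minorant of p that is
   linear along a and along every direction in which p was already linear.
   Doing this once for each vector of the canonical basis gives a linear
   minorant of p_0, that is, a subgradient of L at x. All these derivatives are
   limits of difference quotients with step 1/(m+1), so for a fixed direction
   they are pointwise limits of Borel functions of x, starting from the
   continuous function L: no measurable selection theorem is needed. *)
Require Import Defs.
From mathcomp Require Import all_boot all_order all_algebra.
From mathcomp Require Import ring lra.
From mathcomp Require Import all_classical all_reals all_analysis.
From mathcomp Require Import measurable_realfun.

Set Implicit Arguments.
Unset Strict Implicit.
Unset Printing Implicit Defensive.

Import Order.TTheory GRing.Theory Num.Theory.
Import numFieldNormedType.Exports.

Local Open Scope classical_set_scope.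
Local Open Scope ring_scope.

(** * Convexity, difference quotients and directional derivatives *)

Lemma convex_functionTP (R : realType) (V : lmodType R) (f : V -> R) :
  convex_function setT f <->
  (forall t x y, 0 <= t -> t <= 1 ->
    f (t *: x + (1 - t) *: y) <= t * f x + (1 - t) * f y).
Proof.
split=> [cf t x y t0 t1|cf t x y _ _]; last by apply: cf; [exact: ge0|exact: le1].
by apply: (cf (Itv01 t0 t1)); rewrite inE.
Qed.

Lemma convex_function_shift (R : realType) (V : lmodType R) (f : V -> R) a :
  convex_function [set: V] f -> convex_function [set: V] (fun v => f (a + v)).
Proof.
move=> /convex_functionTP cf; apply/convex_functionTP => t x y t0 t1.
apply: le_trans (cf t (a + x) (a + y) t0 t1).
by rewrite !scalerDr addrACA -scalerDl subrKC scale1r.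
Qed.

Definition slope (R : realType) (V : lmodType R) (f : V -> R) (a v : V) (t : R)
  : R := t^-1 * (f (a + t *: v) - f a).

(** The point a + s v is the convex combination of a + t v and a with weights s/t and 1 - s/t. *)
Lemma slope_le (R : realType) (V : lmodType R) (f : V -> R) (a v : V) (s t : R) :
  convex_function [set: V] f -> 0 < s -> s <= t -> slope f a v s <= slope f a v t.
Proof.
move=> /convex_functionTP cf s0 st.
have t0 : 0 < t by exact: lt_le_trans st.
have st1 : s / t <= 1 by rewrite ler_pdivrMr// mul1r.
have := cf (s / t) (a + t *: v) a (ltW (divr_gt0 s0 t0)) st1.
rewrite scalerDr addrAC -scalerDl subrKC scale1r scalerA.
rewrite divfK ?gt_eqF//.
move=> h; rewrite /slope ler_pdivrMl// mulrA; lra.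
Qed.

(** The point a is the convex combination of a + t v and a - v with weights 1/(1+t) and t/(1+t). The
    bound is independent of t, which makes the slopes converge as t decreases to 0. *)
Lemma slope_ge (R : realType) (V : lmodType R) (f : V -> R) (a v : V) (t : R) :
  convex_function [set: V] f -> 0 < t -> f a - f (a - v) <= slope f a v t.
Proof.
move=> /convex_functionTP cf t0; have t1 : 0 < 1 + t by rewrite addr_gt0.
have := cf (1 + t)^-1 (a + t *: v) (a - v).
rewrite invr_ge0 ltW// invf_le1// lerDl ltW// => /(_ isT isT).
have -> : 1 - (1 + t)^-1 = (1 + t)^-1 * t by field; rewrite gt_eqF.
rewrite -scalerA -scalerDr [t *: (a - v)]scalerBr addrACA subrr addr0.
rewrite -{1}(scale1r a) -scalerDl scalerA mulVf ?gt_eqF// scale1r -mulrA -mulrDr.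
by rewrite ler_pdivlMl// /slope ler_pdivlMl//; lra.
Qed.

(** For convex [f] this limit is the infimum of the slopes over all t > 0, and it is used below only
    through that description and as a limit of a sequence. *)
Definition dirder (R : realType) (V : lmodType R) (f : V -> R) (a v : V) : R :=
  limn (fun m => slope f a v m.+1%:R^-1).

Lemma dirder_cvg (R : realType) (V : lmodType R) (f : V -> R) (a v : V) :
  convex_function [set: V] f ->
  (fun m => slope f a v m.+1%:R^-1) @ \oo --> dirder f a v.
Proof.
move=> cf; apply: nonincreasing_is_cvgn.
  by move=> m k mk; apply: slope_le => //; rewrite lef_pV2 ?posrE ?ler_nat.
by exists (f a - f (a - v)) => _ [m _ <-]; apply: slope_ge.
Qed.

Lemma dirder_ge (R : realType) (V : lmodType R) (f : V -> R) (a v : V) c :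
  convex_function [set: V] f -> (forall t, 0 < t -> c <= slope f a v t) ->
  c <= dirder f a v.
Proof.
move=> cf h; apply: limr_ge; first exact: dirder_cvg.
by near=> m; exact: h.
Unshelve. all: by end_near. Qed.

Lemma dirder_le (R : realType) (V : lmodType R) (f : V -> R) (a v : V) t :
  convex_function [set: V] f -> 0 < t -> dirder f a v <= slope f a v t.
Proof.
move=> cf t0; have [k] := ltr_add_invr t0; rewrite add0r => kt.
apply: le_trans (slope_le _ _ cf _ (ltW kt)) => //.
apply: (nonincreasing_cvgn_ge (u_ := fun m => slope f a v m.+1%:R^-1)).
  by move=> m l ml; apply: slope_le => //; rewrite lef_pV2 ?posrE ?ler_nat.
exact: dirder_cvg.
Qed.

(** * Sublinear functions *)

Definition sublinear (R : realType) (V : lmodType R) (p : V -> R) : Prop :=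
  (forall u v, p (u + v) <= p u + p v) /\
  (forall c v, 0 <= c -> p (c *: v) = c * p v).

Lemma sublinear0 (R : realType) (V : lmodType R) (p : V -> R) :
  sublinear p -> p 0 = 0.
Proof. by case=> _ h; rewrite -(scale0r 0) h// mul0r. Qed.

Lemma sublinear_convex (R : realType) (V : lmodType R) (p : V -> R) :
  sublinear p -> convex_function [set: V] p.
Proof.
case=> pD pZ; apply/convex_functionTP => t x y t0 t1.
by rewrite (le_trans (pD _ _))// !pZ// subr_ge0.
Qed.

Lemma dirder0 (R : realType) (V : lmodType R) (f : V -> R) (a : V) :
  convex_function [set: V] f -> dirder f a 0 = 0.
Proof.
move=> cf; apply/eqP; rewrite eq_le; apply/andP; split.
  apply: le_trans (dirder_le _ _ cf ltr01) _.
  by rewrite /slope scaler0 addr0 subrr mulr0.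
by apply: dirder_ge => // t _; rewrite /slope scaler0 addr0 subrr mulr0.
Qed.

Lemma dirder_sublinear (R : realType) (V : lmodType R) (f : V -> R) (a : V) :
  convex_function [set: V] f -> sublinear (dirder f a).
Proof.
move=> cf; split=> [u v|].
  (* Independent steps s and t allow the two infima to be taken one after the other. Both steps
     shrink to their minimum r, and a + (r/2)(u + v) is the midpoint of a + r u and a + r v. *)
  have key s t : 0 < s -> 0 < t ->
      dirder f a (u + v) <= slope f a u s + slope f a v t.
    move=> s0 t0; pose r := Num.min s t.
    have r0 : 0 < r by rewrite lt_min s0.
    have r20 : 0 < r / 2 by rewrite divr_gt0.
    apply: le_trans (dirder_le _ _ cf r20) _.
    have rs : r <= s by rewrite ge_min lexx.
    have rt : r <= t by rewrite ge_min lexx orbT.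
    apply: le_trans (lerD (slope_le _ u cf r0 rs) (slope_le _ v cf r0 rt)).
    have := (convex_functionTP _).1 cf 2^-1 (a + r *: u) (a + r *: v).
    have -> : 1 - 2^-1 = 2^-1 :> R by lra.
    rewrite invr_ge0 ler0n invf_le1 ?ler1n// => /(_ isT isT).
    rewrite -scalerDr addrACA -mulr2n -(scaler_nat 2 a) -scalerDr (scalerDr 2^-1).
    rewrite !scalerA mulVf// scale1r [_^-1 * r]mulrC => h.
    rewrite /slope invfM invrK -mulrDr -mulrA ler_pM2l ?invr_gt0//; lra.
  rewrite -lerBlDr; apply: dirder_ge => // s s0.
  rewrite lerBlDr -lerBlDl; apply: dirder_ge => // t t0.
  by rewrite lerBlDl key.
(* The reverse inequality is this one for 1/c and the vector c v. *)
have le c v : 0 < c -> c * dirder f a v <= dirder f a (c *: v).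
  move=> c0; apply: dirder_ge => // t t0.
  rewrite -ler_pdivlMl// (le_trans (dirder_le _ _ cf (mulr_gt0 c0 t0)))//.
  by rewrite /slope scalerA [c * t]mulrC invfM mulrA [t^-1 * _]mulrC -mulrA.
move=> c v; rewrite le_eqVlt => /predU1P[<-|c0].
  by rewrite scale0r mul0r dirder0.
apply/eqP; rewrite eq_le le// andbT -ler_pdivrMl//.
apply: le_trans (le _ _ _) _; first by rewrite invr_gt0.
by rewrite scalerA mulVf ?gt_eqF// scale1r.
Qed.

(** * Directional derivatives of sublinear functions *)

Section refinement.
Variables (R : realType) (V : lmodType R) (p : V -> R).
Hypothesis pS : sublinear p.

Lemma dirder_sublinear_le a v : dirder p a v <= p v.
Proof.
apply: le_trans (dirder_le _ _ (sublinear_convex pS) ltr01) _.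
by rewrite /slope invr1 mul1r scale1r lerBlDl; exact: pS.1.
Qed.

(* For p sublinear, p(-u) = -p(u) means that p is linear along u. *)
Lemma dirderN a : dirder p a (- a) = - dirder p a a.
Proof.
have cp := sublinear_convex pS.
have dS := dirder_sublinear a cp.
apply/eqP; rewrite eq_le; apply/andP; split; last first.
  by rewrite -subr_ge0 opprK addrC -(dirder0 a cp) -(subrr a) dS.1.
(* The slope at a along - a with step 1 is p 0 - p a = - p a, so [p a] separates the two sides. *)
rewrite lerNr; apply: le_trans (dirder_sublinear_le a a) _.
rewrite lerNr; apply: le_trans (dirder_le _ _ cp ltr01) _.
by rewrite /slope scale1r subrr (sublinear0 pS) sub0r invr1 mul1r.
Qed.

(** The derivative d lies below p, so d(-u) <= p(-u) = -p(u) <= -d(u); the other inequality is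
    subadditivity of d. *)
Lemma dirder_keepN a u : p (- u) = - p u -> dirder p a (- u) = - dirder p a u.
Proof.
move=> pu; have dS := dirder_sublinear a (sublinear_convex pS).
apply/eqP; rewrite eq_le; apply/andP; split; last first.
  rewrite -subr_ge0 opprK addrC -(dirder0 a (sublinear_convex pS)) -(subrr u).
  exact: dS.1.
by rewrite (le_trans (dirder_sublinear_le _ _))// pu lerN2 dirder_sublinear_le.
Qed.
End refinement.

(** Along each basis vector [p] is homogeneous for all real scalars, so subadditivity bounds [p]
    above by the functional. This bound at - v and 0 <= p(v) + p(-v) give the bound from below. *)
Lemma supporting_functional (R : realType) n (p : 'rV[R]_n -> R) :
  sublinear p -> (forall i, p (- delta_mx 0 i) = - p (delta_mx 0 i)) ->
  forall v, dotprod (\row_i p (delta_mx 0 i)) v <= p v.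
Proof.
move=> pS pN v; have [pD pZ] := pS.
have pe c i : p (c *: delta_mx 0 i) = c * p (delta_mx 0 i).
  have [c0|c0] := leP 0 c; first exact: pZ.
  rewrite -[c]opprK scaleNr -scalerN pZ ?oppr_ge0; last exact: ltW.
  by rewrite pN mulrN opprK !mulNr opprK.
have psum (w : 'rV[R]_n) : p w <= \sum_i w 0 i * p (delta_mx 0 i).
  rewrite {1}[w]row_sum_delta; apply: (big_ind2 (fun x y => p x <= y)) => [||i _].
  - by rewrite (sublinear0 pS).
  - by move=> x a y b xa yb; rewrite (le_trans (pD _ _))// lerD.
  - by rewrite pe.
have h : p (- v) <= - \sum_i v 0 i * p (delta_mx 0 i).
  rewrite -sumrN (le_trans (psum _))//.
  by apply: ler_sum => i _; rewrite mxE mulNr.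
rewrite /dotprod (eq_bigr (fun i => v 0 i * p (delta_mx 0 i))); last first.
  by move=> i _; rewrite mxE mulrC.
move: h; rewrite lerNr => h.
by rewrite (le_trans h)// lerNl -subr_ge0 opprK -(sublinear0 pS) -(addNr v) pD.
Qed.

(** * Iterated directional derivatives *)

Definition iter_dirder (R : realType) (V : lmodType R) (f : V -> R) (s : seq V)
  : V -> R := foldr (fun a p => dirder p a) (dirder f 0) s.

Section iter_dirder.
Variables (R : realType) (V : lmodType R) (f : V -> R).
Hypothesis cf : convex_function [set: V] f.

Lemma iter_dirder_sublinear s : sublinear (iter_dirder f s).
Proof.
elim: s => [|a s IH] /=; first exact: dirder_sublinear.
exact/dirder_sublinear/sublinear_convex.
Qed.

Lemma iter_dirder_le s v : iter_dirder f s v <= f v - f 0.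
Proof.
elim: s => [|a s IH] /=.
  rewrite (le_trans (dirder_le _ _ cf ltr01))//.
  by rewrite /slope invr1 mul1r scale1r add0r.
rewrite (le_trans _ IH)//.
exact: dirder_sublinear_le (iter_dirder_sublinear s) _ _.
Qed.

(** The derivative at the head of the list creates linearity along the head and preserves it along
    the tail. *)
Lemma iter_dirderN (s : seq V) u :
  u \in s -> iter_dirder f s (- u) = - iter_dirder f s u.
Proof.
elim: s => //= a s IH; rewrite inE => /predU1P[->|us].
  exact: dirderN (iter_dirder_sublinear s) _.
exact: dirder_keepN (iter_dirder_sublinear s) _ _ (IH us).
Qed.
End iter_dirder.

(** * Measurability in a parameter *)

Lemma measurable_dirder d (T : measurableType d) (R : realType) (V : lmodType R)
    (F : T -> V -> R) a v :
  (forall x, convex_function [set: V] (F x)) ->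
  (forall w, measurable_fun setT (F ^~ w)) ->
  measurable_fun setT (fun x => dirder (F x) a v).
Proof.
move=> cF mF; apply: (measurable_fun_cvg
  (h := fun m x => slope (F x) a v m.+1%:R^-1)) => [m|x _]; last exact: dirder_cvg.
apply: measurable_funM => //.
exact: measurable_funB.
Qed.

(** The induction keeps [v] general, because the slopes evaluate the previous function at a and at
    all the points a + t v. *)
Lemma measurable_iter_dirder d (T : measurableType d) (R : realType)
    (V : lmodType R) (F : T -> V -> R) s v :
  (forall x, convex_function [set: V] (F x)) ->
  (forall w, measurable_fun setT (F ^~ w)) ->
  measurable_fun setT (fun x => iter_dirder (F x) s v).
Proof.
move=> cF mF; elim: s v => [|a s IH] v /=; apply: measurable_dirder => // x.
exact/sublinear_convex/iter_dirder_sublinear.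
Qed.

(** An open set is a countable union of cubes with rational centre and radius, and the preimage of a
    cube is a finite intersection of coordinate preimages. *)
Lemma borel_measurable_row d (T : measurableType d) (R : realType) n
    (f : T -> 'rV[R]_n) :
  (forall i, measurable_fun setT (fun x => f x 0 i)) ->
  measurable_fun setT (f : T -> borel_rV R n).
Proof.
move=> mf; apply: (@measurability _ _ T (borel_rV R n) setT f (@open 'rV[R]_n)) => //.
move=> _ [U oU <-]; rewrite setTI.
pose B (c : 'rV[rat]_n * rat) : set 'rV[R]_n :=
  [set y | forall i, `|ratr (c.1 0 i) - y 0 i| < ratr c.2].
(* The union runs over the whole countable index type; cubes not contained in [U] contribute the
   empty set. *)
have -> : f @^-1` U = \bigcup_c
    (if `[< B c `<=` U >] then f @^-1` (B c) else set0).
  apply/seteqP; split => [x Ux|x [c _]]; last by case: asboolP => // h /h.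
  have /nbhs_ballP[e /= e0 eU] : nbhs (f x) U by exact: open_nbhs_nbhs.
  (* With r < e/2, a cube of radius r whose centre is within r of f x lies in the e-ball around f
     x. *)
  have [|r] := @rat_in_itvoo R 0 (e / 2); first by rewrite divr_gt0.
  rewrite in_itv /= => /andP[r0 re].
  have /choice[q qP] i : exists q : rat, `|ratr q - f x 0 i| < ratr r.
    have [|q] := @rat_in_itvoo R (f x 0 i - ratr r) (f x 0 i + ratr r).
      by rewrite ltrD2l gtrN.
    by rewrite in_itv /= => qI; exists q; rewrite ltr_distl.
  exists (\row_i q i, r) => //.
  rewrite asboolT => [i|y By]; first by rewrite /= mxE.
  apply: eU; split => // i j; rewrite ord1.
  have /= := By j; rewrite mxE => By'.
  have := qP j; rewrite /ball/= => qPj.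
  rewrite (le_lt_trans (ler_distD (ratr (q j)) _ _))//.
  rewrite distrC (lt_trans (ltrD qPj By'))//; lra.
apply: countable_bigcupT_measurable; first exact: countableP.
move=> c; case: ifPn => // _.
have -> : f @^-1` B c = \bigcap_(i in [set: 'I_n])
    (fun x => f x 0 i) @^-1` [set z | `|ratr (c.1 0 i) - z| < ratr c.2].
  by apply/seteqP; split => x /= h i; [move=> _|]; apply: h.
apply: fin_bigcap_measurable => // i _; rewrite -[X in measurable X]setTI.
apply: mf => //; apply: open_measurable.
exact: (@ball_open _ _ (ratr (c.1 0 i) : R)).
Qed.

(** * Continuity and Borel measurability of convex functions *)

Lemma convex_function_increment_le (R : realType) (V : lmodType R) (f : V -> R) a v c :
  convex_function [set: V] f -> `|c| <= 1 ->
  f (a + c *: v) - f a <= `|c| * (`|f (a + v) - f a| + `|f (a - v) - f a|).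
Proof.
move=> cf c1.
(* This compares the slopes at t and 1. A negative c is the step - c along - v, so the sum of two
   absolute values covers both signs. *)
have pos t u : 0 <= t -> t <= 1 ->
    f (a + t *: u) - f a <= t * `|f (a + u) - f a|.
  rewrite le_eqVlt => /predU1P[<- _|t0 t1].
    by rewrite scale0r addr0 subrr mul0r.
  rewrite -ler_pdivrMl// (le_trans (slope_le _ _ cf t0 t1))//.
  by rewrite /slope invr1 mul1r scale1r ler_norm.
have [c0|c0] := leP 0 c; move: c1.
  rewrite ger0_norm// => c1; rewrite (le_trans (pos _ _ c0 c1))//.
  by apply: ler_wpM2l; rewrite // lerDl.
rewrite ltr0_norm// => c1.
rewrite -[in leLHS](opprK c) scaleNr -scalerN.
have nc0 : 0 <= - c by rewrite oppr_ge0 ltW.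
rewrite (le_trans (pos _ _ nc0 c1))//.
by apply: ler_wpM2l; rewrite ?lerDr.
Qed.

Lemma ler_norm_coord (R : realType) n (v : 'rV[R]_n) i : `|v 0 i| <= `|v|.
Proof.
rewrite [leRHS]/Num.norm /= mx_normrE; apply/bigmax_geP; right => /=.
by exists (0, i).
Qed.

(* By induction on the coordinates, using that x + (u + w) is the midpoint of
   x + 2u and x + 2w. *)
Lemma convex_function_upper_bound (R : realType) n (f : 'rV[R]_n -> R) x :
  convex_function [set: 'rV[R]_n] f ->
  exists C d : R, [/\ 0 <= C, 0 < d &
    forall v, `|v| <= d -> f (x + v) - f x <= C * `|v|].
Proof.
(* Restricting the expansion of v to a list of coordinates makes induction on that list possible. *)
move=> cf; suff [C [d [C0 d0 h]]] : exists C d : R, [/\ 0 <= C, 0 < d &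
    forall v : 'rV[R]_n, `|v| <= d ->
    f (x + \sum_(i <- index_enum 'I_n) v 0 i *: delta_mx 0 i) - f x <= C * `|v|].
  by exists C, d; split => // v /h; rewrite -row_sum_delta.
elim: (index_enum _) => [|i s [C [d [C0 d0 IH]]]].
  exists 0, 1; split => // v _; by rewrite big_nil addr0 subrr mul0r.
set e : 'rV[R]_n := delta_mx 0 i.
pose K := `|f (x + e) - f x| + `|f (x - e) - f x|.
have K0 : 0 <= K by rewrite addr_ge0.
(* The midpoint doubles both parts: the radius ensures |2 v_i| <= 1 and |2 v| <= d, and the constant
   is half of 2 C + 2 K. *)
exists (C + K), (Num.min 1 d / 2); split.
- by rewrite addr_ge0.
- by rewrite divr_gt0// lt_min ltr01.
move=> v; rewrite ler_pdivlMr// le_min => /andP[v1 vd].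
rewrite big_cons -/e; set w := \sum_(_ <- _) _.
have vi := ler_norm_coord v i.
have n2 (u : 'rV[R]_n) : `|2 *: u| = `|u| * 2.
  by rewrite normrZ ger0_norm// mulrC.
have h1 : f (x + (2 * v 0 i) *: e) - f x <= 2 * `|v| * K.
  have n2i : `|2 * v 0 i| = 2 * `|v 0 i| by rewrite normrM ger0_norm.
  apply: le_trans (convex_function_increment_le _ _ cf _) _; rewrite n2i; first lra.
  by rewrite ler_wpM2r// ler_wpM2l.
have h2 : f (x + 2 *: w) - f x <= C * (`|v| * 2).
  have -> : 2 *: w = \sum_(j <- s) (2 *: v) 0 j *: delta_mx 0 j.
    by rewrite scaler_sumr; apply: eq_bigr => j _; rewrite mxE scalerA.
  by rewrite -n2 IH// n2.
have := (convex_functionTP _).1 cf 2^-1 (x + (2 * v 0 i) *: e) (x + 2 *: w).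
have -> : 1 - 2^-1 = 2^-1 :> R by lra.
rewrite invr_ge0 ler0n invf_le1 ?ler1n// => /(_ isT isT).
have -> : 2^-1 *: (x + (2 * v 0 i) *: e) + 2^-1 *: (x + 2 *: w) =
    x + (v 0 i *: e + w).
  rewrite -scalerDr addrACA -mulr2n -(scaler_nat 2 x) -scalerA -!scalerDr.
  by rewrite scalerA mulVf// scale1r.
move: (K) K0 h1 h2 => {}K K0 h1 h2 h3; lra.
Qed.

(** The upper bound at - v also bounds f from below, since f(x) - f(x+v) <= f(x-v) - f(x) by
    convexity. *)
Lemma convex_function_continuous (R : realType) n (f : 'rV[R]_n -> R) :
  convex_function [set: 'rV[R]_n] f -> continuous f.
Proof.
move=> cf x; have [C [d [C0 d0 h]]] := convex_function_upper_bound x cf.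
have hb v : `|v| <= d -> `|f x - f (x + v)| <= C * `|v|.
  move=> vd; rewrite distrC ler_norml h// andbT.
  have := h (- v); rewrite normrN => /(_ vd) h'.
  have := slope_ge x v cf ltr01; rewrite /slope invr1 mul1r scale1r; lra.
have near_x r : 0 < r -> \forall y \near x, `|y - x| < r.
  move=> r0; apply/nbhs_ballP; exists r => //= y.
  by rewrite mx_norm_ball /ball_ /= distrC.
apply/(@cvgrPdist_lt _ _ _ _ (nbhs_filter x)) => e e0.
(* Dividing by C + 1 allows C = 0. *)
have e1 : 0 < e / (C + 1) by rewrite divr_gt0// ltr_wpDl.
have m0 : 0 < Num.min d (e / (C + 1)) by rewrite lt_min d0.
apply: filterS (near_x _ m0) => y; rewrite lt_min => /andP[yd ye].
rewrite -(subrKC x y) (le_lt_trans (hb _ (ltW yd)))//.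
rewrite (@le_lt_trans _ _ ((C + 1) * `|y - x|))// ?ler_wpM2r ?lerDl//.
by rewrite -ltr_pdivlMl ?ltr_wpDl// mulrC.
Qed.

Lemma continuous_borel_measurable (R : realType) n (f : 'rV[R]_n -> R) :
  continuous f -> measurable_fun setT (f : borel_rV R n -> R).
Proof.
move=> /continuousP cf; apply: (measurability _ (RGenOpens.measurableE R)).
move=> _ [_ [a [b ->] <-]]; rewrite setTI.
apply: sub_sigma_algebra; apply: cf; exact: interval_open.
Qed.

(** * The measurable choice of subgradients *)

Theorem proposition3p1 (R : realType) (n : nat) (L : 'rV[R]_n -> R)
    (convL : convex_function [set: 'rV[R]_n] L) :
  exists y : 'rV[R]_n -> 'rV[R]_n,
    borel_measurable y /\ forall x : 'rV[R]_n, subdifferential L x (y x).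
Proof.
pose s := [seq delta_mx 0 i : 'rV[R]_n | i <- enum 'I_n].
pose p x := iter_dirder (fun v => L (x + v)) s.
have cL x := convex_function_shift x convL.
exists (fun x => \row_i p x (delta_mx 0 i)); split=> [|x z].
  apply: borel_measurable_row => i; under eq_fun do rewrite mxE.
  apply: measurable_iter_dirder => // w.
  (* For fixed w the function of x to be measured is a translate of [L], which is convex and hence
     continuous. *)
  have := convex_function_continuous (convex_function_shift w convL).
  move=> /continuous_borel_measurable; congr (measurable_fun _ _).
  by apply/funext => x /=; rewrite addrC.
have pS := iter_dirder_sublinear (cL x) s.
have pN i : p x (- delta_mx 0 i) = - p x (delta_mx 0 i).
  by apply: iter_dirderN => //; apply: map_f; rewrite mem_enum.
(* The functional at z - x is at most p x (z - x), which is at most L(x + (z - x)) - L(x + 0). *)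
rewrite addrC -lerBrDr (le_trans (supporting_functional pS pN _))//.
by rewrite (le_trans (iter_dirder_le (cL x) _ _))// addr0 subrKC.
Qed.
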